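(* There is an algorithm that takes as input a unary FA-presentation $(a^*,\phi)$ of an algebra $\mathcal{S}$ (with finitely many operations, given by finite automata recognizing the relations of the presentation), a finite set $X\subseteq a^*$, and a word $w\in a^*$, and decides whether $w\phi$ lies in the subalgebra of $\mathcal{S}$ generated by $X\phi$.
   Context: For words $w_1,\dots,w_n$ over a finite alphabet $A$, $\mathrm{conv}(w_1,\dots,w_n)$ is the word over $(A\cup\{\$\})^n$ ($\$$ a new symbol) whose $j$-th letter is the tuple of $j$-th letters of the $w_i$, shorter words padded at the end with $\$$. A relation $R\subseteq (A^* )^n$ is regular if $\{\mathrm{conv}(w_1,\dots,w_n):(w_1,\dots,w_n)\in R\}$ is regular. An algebra is regarded as a relational structure by replacing each $k$-ary operation $f$ by its graph $\{(x_1,\dots,x_k,(x_1,\dots,x_k)f)\}$. An FA-presentation of a relational structure $\mathcal{S}=(S,R_1,\dots,R_n)$ is a pair $(L,\phi)$ with $L$ a regular language and $\phi:L\to S$ surjective such that for each $R\in\{=,R_1,\dots,R_n\}$ of arity $r$, $\{(w_1,\dots,w_r)\in L^r: R(w_1\phi,\dots,w_r\phi)\}$ is regular; it is unary if $L$ is over a one-letter alphabet. *)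

(* Defs.v *)
From mathcomp Require Import all_boot.
From mathcomp Require Import classical_sets.

Set Implicit Arguments.
Unset Strict Implicit.
Unset Printing Implicit Defensive.

Local Open Scope classical_set_scope.

(* Codes carry no arity: a code denotes a partial function on finite sequences
   of arguments, in which missing arguments read as 0 and superfluous ones are
   ignored.  On argument lists of the right length this is Kleene's usual
   semantics. *)
Inductive recfun : Type :=
| Zero
| Succ
| Proj of nat
| Comp of recfun & seq recfun
| PrimRec of recfun & recfun
| Mu of recfun.

Inductive eval : recfun -> seq nat -> nat -> Prop :=
| eval_zero xs : eval Zero xs 0
| eval_succ xs : eval Succ xs (nth 0 xs 0).+1
| eval_proj i xs : eval (Proj i) xs (nth 0 xs i)
| eval_comp f gs xs ys y :
    evals gs xs ys -> eval f ys y -> eval (Comp f gs) xs y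
| eval_rec0 f g xs y : eval f xs y -> eval (PrimRec f g) (0 :: xs) y
| eval_recS f g n xs y z :
    eval (PrimRec f g) (n :: xs) y -> eval g (n :: y :: xs) z ->
    eval (PrimRec f g) (n.+1 :: xs) z
| eval_mu f xs n :
    (forall m, m < n -> exists k, eval f (m :: xs) k.+1) ->
    eval f (n :: xs) 0 -> eval (Mu f) xs n
with evals : seq recfun -> seq nat -> seq nat -> Prop :=
| evals_nil xs : evals [::] xs [::]
| evals_cons g gs xs y ys :
    eval g xs y -> evals gs xs ys -> evals (g :: gs) xs (y :: ys).

Definition recfun_nested_ind (P : recfun -> Prop)
    (P0 : P Zero) (PS : P Succ) (Pproj : forall i, P (Proj i))
    (Pcomp : forall f gs, P f -> foldr (fun g Q => P g /\ Q) True gs ->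
               P (Comp f gs))
    (Prec : forall f g, P f -> P g -> P (PrimRec f g))
    (Pmu : forall f, P f -> P (Mu f)) : forall c, P c :=
  fix ind c : P c :=
    match c with
    | Zero => P0
    | Succ => PS
    | Proj i => Pproj i
    | Comp f gs =>
        Pcomp f gs (ind f)
          ((fix all_ind gs : foldr (fun g Q => P g /\ Q) True gs :=
              match gs with
              | [::] => I
              | g :: gs' => conj (ind g) (all_ind gs')
              end) gs)
    | PrimRec f g => Prec f g (ind f) (ind g)
    | Mu f => Pmu f (ind f)
    end.

Lemma eval_functional c xs y z : eval c xs y -> eval c xs z -> y = z.
Proof.
elim/recfun_nested_ind: c xs y z => [||i|f gs IHf IHgs|f g IHf IHg|f IHf].
- by move=> xs y z Hy Hz; inversion Hy; inversion Hz.
- by move=> xs y z Hy Hz; inversion Hy; inversion Hz.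
- by move=> xs y z Hy Hz; inversion Hy; inversion Hz.
- move=> xs y z Hy Hz; inversion Hy as [ | | |? ? ? ys ? Hys Hfy| | |]; subst.
  inversion Hz as [ | | |? ? ? zs ? Hzs Hfz| | |]; subst.
  suff E : ys = zs by rewrite -E in Hfz; exact: IHf Hfy Hfz.
  clear - IHgs Hys Hzs.
  elim: gs ys zs IHgs Hys Hzs => [|g gs IH] ys zs.
    by move=> _ Hys Hzs; inversion Hys; inversion Hzs.
  move=> /= [IHg IHgs] Hys Hzs.
  inversion Hys as [|? ? ? y ys' Hy Hys']; subst.
  inversion Hzs as [|? ? ? z zs' Hz Hzs']; subst.
  by rewrite (IHg _ _ _ Hy Hz) (IH _ _ IHgs Hys' Hzs').
- case=> [|n xs] y z Hy Hz; first by inversion Hy.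
  elim: n y z Hy Hz => [|n IHn] y z Hy Hz.
    inversion Hy as [| | | |? ? ? ? Hfy| |]; subst.
    inversion Hz as [| | | |? ? ? ? Hfz| |]; subst.
    exact: IHf Hfy Hfz.
  inversion Hy as [| | | | |? ? ? ? y' ? Hy' Hgy|]; subst.
  inversion Hz as [| | | | |? ? ? ? z' ? Hz' Hgz|]; subst.
  have E := IHn _ _ Hy' Hz'; rewrite -E in Hgz.
  exact: IHg Hgy Hgz.
- move=> xs y z Hy Hz.
  inversion Hy as [| | | | | |? ? ? Hlty Hfy]; subst.
  inversion Hz as [| | | | | |? ? ? Hltz Hfz]; subst.
  case: (ltngtP y z) => // H.
    by have [k Hk] := Hltz _ H; have := IHf _ _ _ Hk Hfy.
  by have [k Hk] := Hlty _ H; have := IHf _ _ _ Hk Hfz.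
Qed.

(* The states are the finitely many natural numbers occurring in the lists. *)
Record nfa (A : Type) := Nfa {
  nfa_init : seq nat;
  nfa_final : seq nat;
  nfa_trans : seq (nat * A * nat) }.

Fixpoint nfa_accepts_from (A : eqType) (M : nfa A) (p : nat) (u : seq A) :=
  if u is a :: v then
    has (fun t => [&& t.1.1 == p, t.1.2 == a & nfa_accepts_from M t.2 v])
        (nfa_trans M)
  else p \in nfa_final M.

Definition nfa_lang (A : eqType) (M : nfa A) : set (seq A) :=
  [set u | has (fun p => nfa_accepts_from M p u) (nfa_init M)].

Definition regular (A : finType) (L : set (seq A)) :=
  exists M : nfa A, nfa_lang M = L.

(* [None] is the padding symbol. *)
Definition letter (A : Type) (r : nat) := r.-tuple (option A).

Definition conv (A : Type) (r : nat) (ws : r.-tuple (seq A)) :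
    seq (letter A r) :=
  mkseq (fun j => [tuple onth (tnth ws i) j | i < r])
        (\max_(i < r) size (tnth ws i)).

Definition conv_lang (A : Type) (r : nat) (R : set (r.-tuple (seq A))) :
    set (seq (letter A r)) :=
  [set conv ws | ws in R].

Definition regular_rel (A : finType) (r : nat) (R : set (r.-tuple (seq A))) :=
  @regular (r.-tuple (option A)) (conv_lang R).

Definition structure (S : Type) (n : nat) (ar : 'I_n -> nat) :=
  forall i : 'I_n, set ((ar i).-tuple S).

(* The family of relations =, R_1, ..., R_n, equality having index [None]. *)
Definition ar_eq (n : nat) (ar : 'I_n -> nat) (o : option 'I_n) : nat :=
  if o is Some i then ar i else 2.

Definition rel_eq (S : Type) (n : nat) (ar : 'I_n -> nat)
    (R : structure S ar) (o : option 'I_n) : set ((ar_eq ar o).-tuple S) :=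
  match o return set ((ar_eq ar o).-tuple S) with
  | Some i => R i
  | None => [set t | tnth t ord0 = tnth t ord_max]
  end.

Arguments rel_eq {S n ar} R o _.

Definition pullback (A S : Type) (L : set (seq A)) (phi : seq A -> S)
    (r : nat) (R : set (r.-tuple S)) : set (r.-tuple (seq A)) :=
  [set ws | (forall i, L (tnth ws i)) /\ R (map_tuple phi ws)].

(* Only the restriction of [phi] to [L] matters. *)
Record fa_presentation (A : finType) (S : Type) (n : nat) (ar : 'I_n -> nat)
    (R : structure S ar) (L : set (seq A)) (phi : seq A -> S) : Prop := {
  fap_regular : regular L;
  fap_surj : phi @` L = setT;
  fap_rel : forall o, regular_rel (pullback L phi (rel_eq R o)) }.

Definition rel_automata (A : Type) (n : nat) (ar : 'I_n -> nat) :=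
  forall o : option 'I_n, nfa (letter A (ar_eq ar o)).

Definition recognize_presentation (A : finType) (S : Type) (n : nat)
    (ar : 'I_n -> nat) (R : structure S ar) (L : set (seq A))
    (phi : seq A -> S) (D : rel_automata A ar) :=
  forall o, @nfa_lang ((ar_eq ar o).-tuple (option A)) (D o) =
            conv_lang (pullback L phi (rel_eq R o)).

Definition algebra (S : Type) (n : nat) (ar : 'I_n -> nat) :=
  forall i : 'I_n, (ar i).-tuple S -> S.

Definition graph_structure (S : Type) (n : nat) (ar : 'I_n -> nat)
    (op : algebra S ar) : structure S (fun i => (ar i).+1) :=
  fun i => [set t | exists x : (ar i).-tuple S, t = [tuple of rcons x (op i x)]].

Definition subalgebra (S : Type) (n : nat) (ar : 'I_n -> nat)
    (op : algebra S ar) (T : set S) :=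
  forall i (x : (ar i).-tuple S), (forall j, T (tnth x j)) -> T (op i x).

Definition generated (S : Type) (n : nat) (ar : 'I_n -> nat)
    (op : algebra S ar) (G : set S) : set S :=
  smallest (subalgebra op) G.

Definition code_letter (r : nat) (a : letter unit r) : nat :=
  CodeSeq.code [seq nat_of_bool (isSome x) | x <- a].

Definition code_trans (r : nat) (t : nat * letter unit r * nat) : nat :=
  CodeSeq.code [:: t.1.1; code_letter t.1.2; t.2].

Definition code_nfa (r : nat) (M : nfa (letter unit r)) : nat :=
  CodeSeq.code [:: CodeSeq.code (nfa_init M);
                   CodeSeq.code (nfa_final M);
                   CodeSeq.code [seq code_trans t | t <- nfa_trans M]].

(* Each relation is listed with its arity, equality first. *)
Definition code_automata (n : nat) (ar : 'I_n -> nat)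
    (D : rel_automata unit ar) : nat :=
  CodeSeq.code
    [seq CodeSeq.code [:: ar_eq ar o; code_nfa (D o)]
    | o <- None :: [seq Some i | i <- enum 'I_n]].

(* A word over a one-letter alphabet is given by its length. *)
Definition code_words (X : seq (seq unit)) : nat :=
  CodeSeq.code [seq size x | x <- X].

(* Main.v *)
Require Import Defs.
From mathcomp Require Import all_boot.
From mathcomp Require Import boolp classical_sets zify.

(* Words over one letter are natural numbers, so the relations of the
   presentation become rules deriving a number from a tuple of numbers, and the
   problem is membership in the closure T of a finite set under these rules.
   An automaton cannot measure a long gap between two components of a tuple:
   for suitable N and p, a rule is preserved when all components above a gap of
   length at least N are translated by a multiple d of p.

   T is ultimately periodic.  Among the windows [h, h + W) with W large, two with
   starting points h and h + d congruent modulo p carry the same pattern of T.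
   Then {x < h | x in T} U {x >= h | x + d in T} is closed under the rules,
   because every tuple has a gap inside the window, above which it may be
   translated by d.  Hence it contains T, that is, T + d lies in T above h.

   Consequently both answers have finite certificates: for membership, a bound n
   such that every subset of [0, n) containing the generators and closed under
   the rules within [0, n) contains w; for non-membership, such a subset avoiding
   w and periodic on a part of [0, n) long enough for the periodic extension to
   be closed.  The algorithm searches for the first certificate. *)

Set Implicit Arguments.
Unset Strict Implicit.
Unset Printing Implicit Defensive.

(** * Computable functions *)

(* [E] is the type of environments and [vars] lists the variables, that is, the
   arguments of the recursive function; functions are stated over [E] so that
   bound variables are projections of pairs instead of de Bruijn indices. *)
Definition computable (E : Type) (vars : seq (E -> nat)) (f : E -> nat) :=
  exists c, forall e, eval c [seq v e | v <- vars] (f e).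

Definition bind (E : Type) (vars : seq (E -> nat)) : seq (E * nat -> nat) :=
  snd :: [seq v \o fst | v <- vars].

Lemma map_bind E (vars : seq (E -> nat)) e i :
  [seq v (e, i) | v <- bind vars] = i :: [seq v e | v <- vars].
Proof. by rewrite /bind /= -map_comp. Qed.

(** Under [Comp] a code receives only the arguments listed, so the environment, less its first [m]
    entries, is handed on by projections. *)
Lemma evals_projs m xs :
  evals [seq Proj i | i <- iota m (size xs - m)] xs (drop m xs).
Proof.
move Ek : (size xs - m) => k.
elim: k m Ek => [|k IHk] m Ek.
  rewrite drop_oversize; first exact: evals_nil.
  by rewrite -subn_eq0 Ek.
have lt_m : m < size xs by rewrite -subn_gt0 Ek.
rewrite (drop_nth 0 lt_m) /=.
apply: evals_cons; first exact: eval_proj.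
by apply: IHk; rewrite subnS Ek.
Qed.

Section Closure.
Variables (E : Type) (vars : seq (E -> nat)).
Implicit Types f g : E -> nat.

Lemma eq_computable f g : f =1 g -> computable vars f -> computable vars g.
Proof. by move=> eq_fg [c cP]; exists c => e; rewrite -eq_fg. Qed.

Lemma computable_var i : computable vars (nth (fun=> 0) vars i).
Proof.
exists (Proj i) => e.
suff -> : nth (fun=> 0) vars i e = nth 0 [seq v e | v <- vars] i by apply: eval_proj.
case: (ltnP i (size vars)) => [lt_i|ge_i].
  by rewrite (nth_map (fun=> 0)).
by rewrite !nth_default ?size_map.
Qed.

(** The step sees counter, accumulator and then [vars], the order in which [eval_recS] passes its
    arguments. *)
Lemma computable_iteri (t a : E -> nat) (s : E -> nat -> nat -> nat) :
  computable vars t -> computable vars a ->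
  computable (E := E * nat * nat)
    ((fun e => e.1.2) :: snd :: [seq v \o fst \o fst | v <- vars])
    (fun e => s e.1.1 e.1.2 e.2) ->
  computable vars (fun e => iteri (t e) (s e) (a e)).
Proof.
move=> [ct tP] [ca aP] [cs sP].
exists (Comp (PrimRec ca cs) (ct :: [seq Proj i | i <- iota 0 (size vars)])) => e.
apply: eval_comp.
  apply: evals_cons; first exact: tP.
  have := evals_projs 0 [seq v e | v <- vars].
  by rewrite drop0 subn0 size_map; apply.
elim: (t e) => [|m IHm]; first by apply: eval_rec0; apply: aP.
apply: eval_recS IHm _.
have := sP (e, m, iteri m (s e) (a e)).
by rewrite /= -map_comp.
Qed.

Lemma computable0 : computable vars (fun=> 0).
Proof. by exists Zero => e; apply: eval_zero. Qed.

Lemma computableS f : computable vars f -> computable vars (fun e => (f e).+1).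
Proof.
move=> [c cP]; exists (Comp Succ [:: c]) => e.
apply: (eval_comp (ys := [:: f e])); last exact: eval_succ.
by apply: evals_cons (cP e) (evals_nil _).
Qed.

Lemma computable_const m : computable vars (fun=> m).
Proof. by elim: m => [|m IHm]; [apply: computable0 | apply: computableS]. Qed.

Lemma computable_app1 (F : nat -> nat) f :
  computable [:: id] F -> computable vars f -> computable vars (fun e => F (f e)).
Proof.
move=> [cF FP] [c cP]; exists (Comp cF [:: c]) => e.
apply: eval_comp (FP (f e)).
by apply: evals_cons (cP e) (evals_nil _).
Qed.

Lemma computable_app2 (F : nat -> nat -> nat) f g :
  computable [:: fst; snd] (fun u => F u.1 u.2) ->
  computable vars f -> computable vars g ->
  computable vars (fun e => F (f e) (g e)).
Proof.
move=> [cF FP] [c cP] [d dP]; exists (Comp cF [:: c; d]) => e.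
apply: eval_comp (FP (f e, g e)).
by apply: evals_cons (cP e) _; apply: evals_cons (dP e) (evals_nil _).
Qed.

End Closure.

Ltac var_from i :=
  first [exact: (computable_var _ i)
        | lazymatch i with 12 => fail | _ => var_from (S i) end].

Ltac var := var_from 0.

Lemma computable_add E vars (f g : E -> nat) :
  computable vars f -> computable vars g -> computable vars (fun e => f e + g e).
Proof.
apply: computable_app2.
apply: (eq_computable (f := fun u => iteri u.1 (fun=> succn) u.2)).
  by case=> m n /=; elim: m => //= m ->.
by apply: computable_iteri; [var | var | apply: computableS; var].
Qed.

Lemma computable_pred E vars (f : E -> nat) :
  computable vars f -> computable vars (fun e => (f e).-1).
Proof.
apply: computable_app1.
apply: (eq_computable (f := fun m => iteri m (fun i _ => i) 0)); first by case.
by apply: computable_iteri; [var | apply: computable0 | var].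
Qed.

Lemma computable_sub E vars (f g : E -> nat) :
  computable vars f -> computable vars g -> computable vars (fun e => f e - g e).
Proof.
apply: computable_app2.
apply: (eq_computable (f := fun u => iteri u.2 (fun=> predn) u.1)).
  by case=> m n /=; elim: n => [|n /= ->]; rewrite ?subn0 ?subnS.
by apply: computable_iteri; [var | var | apply: computable_pred; var].
Qed.

Lemma computable_mul E vars (f g : E -> nat) :
  computable vars f -> computable vars g -> computable vars (fun e => f e * g e).
Proof.
apply: computable_app2.
apply: (eq_computable (f := fun u => iteri u.1 (fun=> addn u.2) 0)).
  by case=> m n /=; elim: m => //= m ->; rewrite mulSn.
apply: computable_iteri; [var | exact: computable0 | apply: computable_add; var].
Qed.

Lemma computable_eq0 E vars (f : E -> nat) :
  computable vars f -> computable vars (fun e => f e == 0).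
Proof.
apply: (computable_app1 (F := fun m => m == 0)).
apply: (eq_computable (f := fun m => iteri m (fun _ _ => 0) 1)); first by case.
by apply: computable_iteri; [var | apply: computable_const | apply: computable0].
Qed.

Lemma computable_neg E vars (P : E -> bool) :
  computable vars P -> computable vars (fun e => ~~ P e).
Proof.
move=> /computable_eq0; apply: eq_computable => e.
by rewrite /=; case: (P e).
Qed.

Lemma computable_and E vars (P Q : E -> bool) :
  computable vars P -> computable vars Q -> computable vars (fun e => P e && Q e).
Proof.
move=> PP QQ; apply: eq_computable (computable_mul PP QQ) => e.
by rewrite mulnb.
Qed.

Lemma computable_or E vars (P Q : E -> bool) :
  computable vars P -> computable vars Q -> computable vars (fun e => P e || Q e).
Proof.
move=> PP QQ.
apply: eq_computable
  (computable_neg (computable_and (computable_neg PP) (computable_neg QQ))).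
by move=> e; rewrite /= negb_and !negbK.
Qed.

Lemma computable_implies E vars (P Q : E -> bool) :
  computable vars P -> computable vars Q -> computable vars (fun e => P e ==> Q e).
Proof.
move=> PP QQ; apply: eq_computable (computable_or (computable_neg PP) QQ).
by move=> e; rewrite implybE.
Qed.

Lemma computable_leq E vars (f g : E -> nat) :
  computable vars f -> computable vars g -> computable vars (fun e => f e <= g e).
Proof. by move=> fP gP; apply: computable_eq0; apply: computable_sub. Qed.

Lemma computable_eqn E vars (f g : E -> nat) :
  computable vars f -> computable vars g -> computable vars (fun e => f e == g e).
Proof.
move=> fP gP.
apply: eq_computable (computable_and (computable_leq fP gP) (computable_leq gP fP)).
by move=> e; rewrite /= eqn_leq.
Qed.

Lemma computable_eqb E vars (P Q : E -> bool) :
  computable vars P -> computable vars Q -> computable vars (fun e => P e == Q e).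
Proof.
move=> PP QQ; apply: eq_computable (computable_eqn PP QQ).
by move=> e; case: (P e); case: (Q e).
Qed.

Lemma computable_sum E vars (t : E -> nat) (F : E -> nat -> nat) :
  computable vars t -> computable (bind vars) (fun u => F u.1 u.2) ->
  computable vars (fun e => \sum_(0 <= i < t e) F e i).
Proof.
move=> tP [c cP].
apply: (eq_computable (f := fun e => iteri (t e) (fun i y => y + F e i) 0)).
  by move=> e; elim: (t e) => [|m IHm]; [rewrite big_geq | rewrite big_nat_recr //= IHm].
apply: computable_iteri => //; first exact: computable0.
apply: computable_add; first by var.
(* The environment is [i :: y :: vars]; the summand must not see the accumulator [y], so position 1
   is skipped. *)
exists (Comp c (Proj 0 :: [seq Proj i | i <- iota 2 (size vars)])) => -[[e i] y] /=.
apply: eval_comp (cP (e, i)); rewrite map_bind -map_comp.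
apply: evals_cons; first exact: (eval_proj 0).
have := evals_projs 2 (i :: y :: [seq v e | v <- vars]).
by rewrite /= size_map drop0 subn2; apply.
Qed.

Lemma computable_all_iota E vars (t : E -> nat) (P : E -> nat -> bool) :
  computable vars t -> computable (bind vars) (fun u => P u.1 u.2) ->
  computable vars (fun e => all (P e) (iota 0 (t e))).
Proof.
move=> tP PP.
have := computable_eq0
  (computable_sum (F := fun e i => ~~ P e i) tP (computable_neg PP)).
apply: eq_computable => e; congr nat_of_bool.
rewrite big_mkord sum_nat_eq0; apply/forallP/allP => [Pe i|Pe i].
  rewrite mem_iota => /= lt_i.
  by have := Pe (Ordinal lt_i); rewrite /=; case: (P e i).
by rewrite Pe // mem_iota /=.
Qed.

Lemma computable_has_iota E vars (t : E -> nat) (P : E -> nat -> bool) :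
  computable vars t -> computable (bind vars) (fun u => P u.1 u.2) ->
  computable vars (fun e => has (P e) (iota 0 (t e))).
Proof.
move=> tP PP.
have := computable_neg
  (computable_all_iota (P := fun e i => ~~ P e i) tP (computable_neg PP)).
by apply: eq_computable => e; rewrite (all_predC (P e)) negbK.
Qed.

Lemma computable_exp2 E vars (f : E -> nat) :
  computable vars f -> computable vars (fun e => 2 ^ f e).
Proof.
apply: (computable_app1 (F := expn 2)).
apply: (eq_computable (f := fun m => iteri m (fun _ y => y + y) 1)).
  by elim=> //= m ->; rewrite expnS mul2n addnn.
apply: computable_iteri; [by var | exact: computable_const | ].
by apply: computable_add; var.
Qed.

Lemma computable_fact E vars (f : E -> nat) :
  computable vars f -> computable vars (fun e => (f e)`!).
Proof.
apply: (computable_app1 (F := factorial)).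
apply: (eq_computable (f := fun m => iteri m (fun i y => i.+1 * y) 1)).
  by elim=> //= m ->; rewrite factS.
apply: computable_iteri; [by var | exact: computable_const | ].
by apply: computable_mul; [apply: computableS|]; var.
Qed.

(** Quotients, exponents of 2, sizes of lists and lengths of words are all computed by counting an
    initial segment in this way. *)
Lemma sum_ltn m q : \sum_(0 <= i < m) (i < q) = minn m q.
Proof.
elim: m => [|m IHm]; first by rewrite big_geq // min0n.
rewrite big_nat_recr //= IHm; case: (ltnP m q) => ?.
  by rewrite addn1 !(minn_idPl _) // ltnW.
by rewrite addn0 !(minn_idPr _) // leqW.
Qed.

Lemma computable_div E vars (f g : E -> nat) :
  computable vars f -> computable vars g -> computable vars (fun e => f e %/ g e).
Proof.
apply: computable_app2.
(* The quotient counts the positive multiples of [u.2] up to [u.1]; the test [0 < u.2] gives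
   division by zero the value 0. *)
apply: (eq_computable (f := fun u =>
  \sum_(0 <= i < u.1) ((0 < u.2) && (i.+1 * u.2 <= u.1)))).
  case=> m [|d] /=; first by rewrite divn0 big1.
  under eq_bigr do rewrite -leq_divRL //.
  by rewrite sum_ltn; apply/minn_idPr/leq_div.
apply: computable_sum; first by var.
apply: computable_and; apply: computable_leq; try var; first exact: computable_const.
by apply: computable_mul; [apply: computableS|]; var.
Qed.

Lemma computable_dvd E vars (f g : E -> nat) :
  computable vars f -> computable vars g -> computable vars (fun e => f e %| g e).
Proof.
move=> fP gP; apply: eq_computable
  (computable_eqn gP (computable_mul (computable_div gP fP) fP)).
by move=> e /=; rewrite dvdn_eq eq_sym.
Qed.

(** * Arithmetic of coded sequences *)

Lemma code_cons x s :
  CodeSeq.code (x :: s) = 2 ^ x * (CodeSeq.code s).*2.+1.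
Proof. by []. Qed.

(** The code of a nonempty list is [2 ^ x] times an odd number, so its head is the exponent of 2;
    the empty list has code 0, where the empty sum agrees with the default head. *)
Lemma code_head c :
  head 0 (CodeSeq.decode c) = \sum_(0 <= i < c) (2 ^ i.+1 %| c).
Proof.
rewrite -[c]CodeSeq.decodeK CodeSeq.codeK.
case: (CodeSeq.decode c) => [|x s]; first by rewrite big_geq.
set d := CodeSeq.code _.
have d_gt0 : 0 < d by rewrite /d code_cons muln_gt0 expn_gt0.
have logd : logn 2 d = x.
  rewrite /d code_cons lognM ?expn_gt0 // pfactorK // logn_coprime ?addn0 //.
  by rewrite coprime2n /= odd_double.
under eq_bigr do rewrite pfactor_dvdn // logd.
rewrite sum_ltn; apply/esym/minn_idPr.
by rewrite -logd ltnW // ltn_logl.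
Qed.

(** If [c = 2 ^ x * (2 * m + 1)], the quotient by [2 ^ x.+1] rounds down to [m], the code of the
    tail. *)
Lemma code_behead c :
  CodeSeq.code (behead (CodeSeq.decode c)) =
  c %/ 2 ^ (head 0 (CodeSeq.decode c)).+1.
Proof.
rewrite -{2}[c]CodeSeq.decodeK; case: (CodeSeq.decode c) => [|x s] //=.
rewrite -/(CodeSeq.code _) expnSr divnMl ?expn_gt0 //.
by rewrite divn2 /= uphalf_double.
Qed.

Lemma computable_head E vars (f : E -> nat) :
  computable vars f -> computable vars (fun e => head 0 (CodeSeq.decode (f e))).
Proof.
apply: (computable_app1 (F := fun c => head 0 (CodeSeq.decode c))).
apply: (eq_computable (f := fun c => \sum_(0 <= i < c) (2 ^ i.+1 %| c))) => [c|].
  by rewrite code_head.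
apply: computable_sum; first by var.
by apply: computable_dvd; last var; apply: computable_exp2; apply: computableS; var.
Qed.

Lemma computable_drop E vars (f g : E -> nat) :
  computable vars f -> computable vars g ->
  computable vars (fun e => CodeSeq.code (drop (g e) (CodeSeq.decode (f e)))).
Proof.
apply: (computable_app2 (F := fun c i => CodeSeq.code (drop i (CodeSeq.decode c)))).
apply: (eq_computable (f := fun u => iteri u.2
  (fun _ c => c %/ 2 ^ (head 0 (CodeSeq.decode c)).+1) u.1)).
  case=> c i /=; elim: i => [|i IHi] /=; first by rewrite drop0 CodeSeq.decodeK.
  by rewrite IHi -code_behead CodeSeq.codeK -drop1 drop_drop.
apply: computable_iteri; try var; apply: computable_div; first by var.
by apply: computable_exp2; apply: computableS; apply: computable_head; var.
Qed.

Lemma computable_nth E vars (f g : E -> nat) :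
  computable vars f -> computable vars g ->
  computable vars (fun e => nth 0 (CodeSeq.decode (f e)) (g e)).
Proof.
move=> fP gP; apply: eq_computable (computable_head (computable_drop fP gP)).
by move=> e; rewrite CodeSeq.codeK -nth0 nth_drop addn0.
Qed.

Lemma leq_size_code s : size s <= CodeSeq.code s.
Proof.
elim: s => // x s IHs; rewrite code_cons /=.
apply: (leq_trans (n := (CodeSeq.code s).*2.+1)).
  by rewrite ltnS (leq_trans IHs) // -addnn leq_addr.
by rewrite leq_pmull // expn_gt0.
Qed.

Lemma computable_size E vars (f : E -> nat) :
  computable vars f -> computable vars (fun e => size (CodeSeq.decode (f e))).
Proof.
apply: (computable_app1 (F := fun c => size (CodeSeq.decode c))).
(* The size is the number of nonempty suffixes, those with nonzero code; by [leq_size_code] it is at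
   most [c]. *)
apply: (eq_computable (f := fun c =>
  \sum_(0 <= i < c) (0 < CodeSeq.code (drop i (CodeSeq.decode c))))) => [c|].
  transitivity (\sum_(0 <= i < c) (i < size (CodeSeq.decode c))).
    apply: eq_bigr => i _; congr nat_of_bool; rewrite -[RHS]subn_gt0 -size_drop.
    case: drop => // x s; rewrite code_cons /= muln_gt0 expn_gt0 //.
  by rewrite sum_ltn; apply/minn_idPr; rewrite -{2}[c]CodeSeq.decodeK leq_size_code.
apply: computable_sum; first by var.
by apply: computable_leq; [exact: computable_const | apply: computable_drop; var].
Qed.

Lemma computable_all E vars (f : E -> nat) (P : E -> nat -> bool) :
  computable vars f -> computable (bind vars) (fun u => P u.1 u.2) ->
  computable vars (fun e => all (P e) (CodeSeq.decode (f e))).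
Proof.
move=> fP [c cP].
apply: (eq_computable (f := fun e => all
  (fun i => P e (nth 0 (CodeSeq.decode (f e)) i)) (iota 0 (size (CodeSeq.decode (f e)))))).
  move=> e; congr nat_of_bool; rewrite -all_map.
  by rewrite -[in RHS](mkseq_nth 0 (CodeSeq.decode (f e))).
apply: computable_all_iota; first exact: computable_size.
have [d dP] : computable (bind vars) (fun u => nth 0 (CodeSeq.decode (f u.1)) u.2).
  case: fP => d dP; apply: computable_nth; last by var.
  exists (Comp d [seq Proj i | i <- iota 1 (size vars)]) => -[e i]; rewrite map_bind.
  apply: eval_comp (dP e); have := evals_projs 1 (i :: [seq v e | v <- vars]).
  by rewrite /= size_map drop0 subn1; apply.
exists (Comp c (d :: [seq Proj i | i <- iota 1 (size vars)])) => -[e i].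
rewrite map_bind /=.
apply: eval_comp; last first.
  have := cP (e, nth 0 (CodeSeq.decode (f e)) i).
  by rewrite map_bind; apply.
apply: evals_cons; first by have := dP (e, i); rewrite map_bind.
have := evals_projs 1 (i :: [seq v e | v <- vars]).
by rewrite /= size_map drop0 subn1; apply.
Qed.

Lemma computable_mem E vars (f g : E -> nat) :
  computable vars f -> computable vars g ->
  computable vars (fun e => f e \in CodeSeq.decode (g e)).
Proof.
apply: (computable_app2 (F := fun x c => nat_of_bool (x \in CodeSeq.decode c))).
apply: (eq_computable (f := fun u =>
  ~~ all (fun y => ~~ (y == u.1)) (CodeSeq.decode u.2))).
  by case=> x c /=; rewrite (all_predC (pred1 x)) negbK has_pred1.
apply: computable_neg; apply: computable_all; first by var.
by apply: computable_neg; apply: computable_eqn; var.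
Qed.

(** * Closure under rules with translatable gaps *)

Definition shift (g d x : nat) := if x <= g then x else x + d.

(** No component ends strictly inside the gap, so a convolution reaching across it repeats one
    letter on positions [g] to [g + l - 1]. *)
Definition has_gap (r : nat) (v : nat -> nat) (g l : nat) :=
  forall i, i < r -> v i <= g \/ g + l <= v i.

(** Pigeonhole: of the [k.+1] consecutive blocks of length [l] starting at [h], at most [k] contain
    a component, so some block [s] is free. *)
Lemma has_gapP (r k : nat) (v : nat -> nat) (h l : nat) :
  r <= k -> 0 < l ->
  exists g, [/\ h <= g, g + l <= h + k.+1 * l & has_gap r v g l].
Proof.
move=> le_rk l_gt0.
have /allPn [s s_le /negP s_free] :
    ~~ all [in [seq (v i - h) %/ l | i <- iota 0 r]] (iota 0 k.+1).
  apply/negP => /allP sub; have := uniq_leq_size (iota_uniq 0 k.+1) sub.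
  by rewrite size_map !size_iota; lia.
move: s_le; rewrite mem_iota /= add0n => s_le.
exists (h + s * l); split; [lia | nia | move=> i lt_ir].
have [//|lt_g] := leqP (v i) (h + s * l); first by left.
right; have ne_s : (v i - h) %/ l != s.
  apply/eqP => eq_s; apply: s_free; rewrite -eq_s; apply: map_f.
  by rewrite mem_iota.
have le_s : s <= (v i - h) %/ l by rewrite leq_divRL //; lia.
have : s < (v i - h) %/ l by rewrite ltn_neqAle eq_sym ne_s.
by rewrite leq_divRL //; nia.
Qed.

(* A tuple of naturals is given by a function of which only the values below the
   arity [r o] matter; the last component is derived from the others. *)
Section Rules.

Variables (I : Type) (r : I -> nat) (R : I -> (nat -> nat) -> Prop).
Definition rule_closed (F : nat -> Prop) := forall o v, R o v ->
  (forall i, i < (r o).-1 -> F (v i)) -> F (v (r o).-1).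

Definition rule_closed_below (n : nat) (F : nat -> Prop) := forall o v, R o v ->
  (forall i, i < r o -> v i < n) ->
  (forall i, i < (r o).-1 -> F (v i)) -> F (v (r o).-1).

Definition rule_closure (X : seq nat) (m : nat) :=
  forall F, rule_closed F -> (forall x, x \in X -> F x) -> F m.

Lemma rule_closure_closed X : rule_closed (rule_closure X).
Proof.
move=> o v Rv args F clF subX; apply: (clF _ _ Rv) => i lt_i.
exact: args lt_i F clF subX.
Qed.

(** A derivation involves finitely many numbers, so it remains valid inside every large enough
    [[0, n')]; allowing all [n' >= n] lets the bounds of several premises be merged. *)
Lemma rule_closure_bounded X m : rule_closure X m ->
  exists n, forall n' F, n <= n' -> rule_closed_below n' F ->
    (forall x, x \in X -> F x) -> F m.
Proof.
pose G m := exists n, forall n' F, n <= n' -> rule_closed_below n' F ->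
    (forall x, x \in X -> F x) -> F m.
apply: (_ : rule_closure X m -> G m); apply; last first.
  by move=> x Xx; exists 0 => n F _ _; apply.
move=> o v Rv args.
have [y yP] : {y : nat -> nat & forall i, i < (r o).-1 ->
    forall n' F, y i <= n' -> rule_closed_below n' F ->
    (forall x, x \in X -> F x) -> F (v i)}.
  apply: (choice (P := fun i y => i < (r o).-1 ->
    forall n' F, y <= n' -> rule_closed_below n' F ->
    (forall x, x \in X -> F x) -> F (v i))) => i.
  by have [/args [n nP]|] := ltnP i (r o).-1; [exists n | exists 0].
(* The first summand covers the bounds of the premises, the second places the tuple itself below
   [n]. *)
exists (\max_(i < r o) y i + (\max_(i < r o) v i).+1) => n F le_n clF subX.
have max_le (f : nat -> nat) i : i < r o -> f i <= \max_(i < r o) f i.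
  by move=> lt_i; apply: (leq_bigmax (F := fun i : 'I_(r o) => f i) (Ordinal lt_i)).
apply: (clF _ _ Rv) => i lt_i.
  by have := max_le v i lt_i; lia.
by apply: (yP i lt_i n) => //; have := max_le y i; lia.
Qed.

Variables (K N p : nat).
Hypothesis r_gt0 : forall o, 0 < r o.
Hypothesis r_le : forall o, r o <= K.
Hypothesis N_gt0 : 0 < N.
Hypothesis p_gt0 : 0 < p.
Hypothesis R_ext : forall o u v,
  (forall i, i < r o -> u i = v i) -> R o u -> R o v.
Hypothesis R_shift : forall o v g d, p %| d -> has_gap (r o) v g N ->
  R o v <-> R o (shift g d \o v).

Lemma last_lt o : (r o).-1 < r o.
Proof. by rewrite ltn_predL. Qed.

Lemma rule_closure_shift X :
  exists h d, [/\ 0 < d, p %| d &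
    forall x, h <= x -> rule_closure X x -> rule_closure X (x + d)].
Proof.
set T := rule_closure X.
set W := K.+1 * N; set b := \max_(x <- X) x.
(* There are [2 ^ W] patterns for [2 ^ W + 1] windows. Starting beyond [b] keeps the generators
   below [h], and the spacing [p] makes [d] a multiple of [p]. *)
pose window (t : 'I_(2 ^ W).+1) :=
  [ffun i : 'I_W => `[< T (b.+1 + t * p + i) >]].
have /injectivePn [t1 [t2 ne_t eq_w]] : ~~ injectiveb window.
  apply/negP => /injectiveP /leq_card.
  by rewrite card_ffun card_bool !card_ord ltnn.
wlog lt_t : t1 t2 ne_t eq_w / t1 < t2.
  move=> wl; case: (ltngtP t1 t2) => [lt|lt|eq_t]; first exact: wl lt.
    by apply: wl lt; rewrite 1?eq_sym.
  by case/eqP: ne_t; apply: val_inj.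
set h := b.+1 + t1 * p; set d := (t2 - t1) * p.
have d_gt0 : 0 < d by rewrite /d; nia.
have p_d : p %| d by rewrite dvdn_mull.
exists h, d; split=> // x le_hx Tx.
have agree y : h <= y -> y < h + W -> T y <-> T (y + d).
  move=> le_hy lt_y; have lt_W : y - h < W by lia.
  have /ffunP /(_ (Ordinal lt_W)) := eq_w; rewrite !ffunE /=.
  have -> : b.+1 + t1 * p + (y - h) = y by lia.
  have -> : b.+1 + t2 * p + (y - h) = y + d by rewrite /d /h; nia.
  by move=> eqT; split=> /asboolP; [rewrite eqT|rewrite -eqT] => /asboolP.
pose T' y := if y < h then T y else T (y + d).
have T'E y : y < h + W -> T' y <-> T y.
  by rewrite /T'; case: (ltnP y h) => // le_hy lt_y; apply: iff_sym; exact: agree.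
suff : T' x by rewrite /T' ltnNge le_hx.
apply: Tx => [o v Rv args|y Xy]; last first.
  have le_yb : y <= b by apply: (leq_bigmax_seq (F := id)).
  have lt_yh : y < h by rewrite /h; lia.
  by rewrite /T' lt_yh => F _; apply.
have [g [le_hg le_gW gap]] := has_gapP v h (r_le o) N_gt0.
(* Components below the gap lie where [T'] and [T] agree; those above it exceed [h], where [T'] is
   read off after translation by [d]. *)
have T'_shift i : i < r o -> T' (v i) <-> T (shift g d (v i)).
  move=> lt_i; rewrite /shift; case: leqP => [le_g|lt_g].
    by apply: T'E; rewrite /W; lia.
  by rewrite /T' ltnNge (_ : h <= v i) /=; [split | lia].
apply/(T'_shift _ (last_lt o)).
apply: (@rule_closure_closed X o (shift g d \o v)).
  exact: (proj1 (R_shift p_d gap) Rv).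
by move=> i lt_i; apply/T'_shift; [lia | exact: args].
Qed.

(** [rule_closure_shift] goes one way only. In a residue class modulo [d] that meets the closure
    above [h], every number from a chosen member on belongs to the closure; past all the chosen
    members both directions hold. *)
Lemma rule_closure_periodic X :
  exists h d, [/\ 0 < d, p %| d &
    forall x, h <= x -> rule_closure X x <-> rule_closure X (x + d)].
Proof.
have [h [d [d_gt0 p_d up]]] := rule_closure_shift X.
have up_mul k x : h <= x -> rule_closure X x -> rule_closure X (x + k * d).
  elim: k => [|k IHk] le_hx Tx; first by rewrite addn0.
  by rewrite mulSn [d + _]addnC addnA; apply: up (IHk _ _) => //; lia.
have [y yP] : {y : 'I_d -> nat & forall (c : 'I_d) x, h <= x -> x = c %[mod d] ->
    rule_closure X x -> [/\ h <= y c, y c = c %[mod d] & rule_closure X (y c)]}.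
  apply: (choice (P := fun (c : 'I_d) y => forall x, h <= x -> x = c %[mod d] ->
    rule_closure X x -> [/\ h <= y, y = c %[mod d] & rule_closure X y])) => c.
  have [[y yP]|none] := EM (exists y, [/\ h <= y, y = c %[mod d] & rule_closure X y]).
    by exists y.
  by exists 0 => x le_hx xc Tx; case: none; exists x.
exists (h + \max_(c < d) y c), d; split=> // x le_x.
split=> [|Txd]; first by apply: up; lia.
pose c := Ordinal (ltn_pmod x d_gt0).
have [] := yP c (x + d) _ _ Txd; [lia | by rewrite modnDr modn_mod | ].
move=> le_hy eq_c Ty; have le_yx : y c <= x.
  by apply: leq_trans le_x; rewrite (leq_trans (leq_bigmax (F := y) c)) ?leq_addl.
have -> : x = y c + (x - y c) %/ d * d; last exact: up_mul.
rewrite divnK ?subnKC //.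
by rewrite -eqn_mod_dvd // eq_c /= modn_mod.
Qed.

(* Gaps in a tuple violating closedness of the periodic extension can be
   shortened by [d] until it fits below [n]. *)
Lemma rule_closed_below_extend n h d (F : nat -> Prop) :
  0 < d -> p %| d -> h + K.+1 * (N + d) <= n -> rule_closed_below n F ->
  (forall x, h <= x -> x + d < n -> F x <-> F (x + d)) ->
  exists2 G, rule_closed G & forall x, x < n -> G x <-> F x.
Proof.
move=> d_gt0 p_d le_n clF perF.
(* [G] repeats the pattern of [F] on [[h, h + d)] for ever. *)
pose G x := F (if x < h then x else h + (x - h) %% d).
have GF x : x < n -> G x <-> F x.
  elim/ltn_ind: x => x IHx lt_xn; rewrite /G; case: ltnP => // le_hx.
  have [lt_x|le_x] := ltnP x (h + d).
    by rewrite modn_small ?subnKC //; lia.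
  have -> : x - h = x - d - h + d by lia.
  have := IHx (x - d); rewrite /G modnDr [x - d < h]ltnNge (_ : h <= x - d) /=; last by lia.
  move=> IH; apply: (iff_trans (IH _ _)); [lia | lia |].
  by have := perF (x - d); rewrite subnK; [apply; lia | lia].
have Gd x : h <= x -> G (x + d) <-> G x.
  move=> le_hx; rewrite /G !ltnNge le_hx (_ : h <= x + d) /=; last by lia.
  by rewrite -addnBAC // modnDr; split.
exists G => // o v.
move Em : (\sum_(i < r o) v i) => m.
elim/ltn_ind: m v Em => m IHm v Em Rv args.
have [small|] := EM (forall i, i < r o -> v i < n).
  apply/GF; first exact/small/last_lt.
  by apply: (clF _ _ Rv small) => i lt_i; apply/GF; [apply: small; lia | apply: args].
move=> /existsNP [j /not_implyP [lt_j /negP]]; rewrite -leqNgt => le_nj.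
(* Length [N + d] leaves a gap of length [N] after the shortening, as [R_shift] requires. The gap
   ends by [n], so [v j] lies above it and drops by [d], which decreases the sum of the
   components. *)
have [|g [le_hg le_gn gap]] := has_gapP (l := N + d) v h (r_le o) _; first by lia.
pose u i := if v i <= g then v i else v i - d.
have shift_u i : i < r o -> shift g d (u i) = v i.
  by move=> /gap; rewrite /shift /u; case: (leqP (v i) g) => [->//|?] [?|?]; first lia;
     rewrite ifN ?subnK //; lia.
have gap_u : has_gap (r o) u g N.
  by move=> i /gap; rewrite /u; case: (leqP (v i) g) => ?; lia.
have Gu i : i < r o -> G (u i) <-> G (v i).
  move=> /gap; rewrite /u; case: (leqP (v i) g) => // ? [?|?]; first lia.
  by have := Gd (v i - d); rewrite subnK => [GdE|]; [apply: iff_sym; apply: GdE; lia | lia].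
apply/(Gu _ (last_lt o)).
have Ru : R o u.
  by apply/(R_shift p_d gap_u); apply: R_ext Rv => i lt_i; rewrite /= shift_u.
apply: (IHm (\sum_(i < r o) u i)) => // [|i lt_i]; last first.
  by apply/Gu; [lia | apply: args].
rewrite -Em (bigD1 (Ordinal lt_j)) // [X in _ < X](bigD1 (Ordinal lt_j)) //= -addSn.
apply: leq_add; first by rewrite /u /=; case: ifP; lia.
by apply: leq_sum => i _; rewrite /u; case: ifP; lia.
Qed.

End Rules.

(** * Automata over one letter *)

Lemma mem_ltn_code x s : x \in s -> x < CodeSeq.code s.
Proof. by move=> sx; have /allP := CodeSeq.ltn_code s; apply. Qed.

(** In binary, the code spends [x + 1] digits on an entry [x], hence at most [b]. *)
Lemma code_bound b s :
  all (fun x => x < b) s -> CodeSeq.code s < 2 ^ (b * size s).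
Proof.
elim: s => [|x s IHs]; first by rewrite expn_gt0.
rewrite [all _ _]/= => /andP [lt_xb /IHs lt_s].
rewrite code_cons -[size _]/(size s).+1 [b * _]mulnS expnD.
apply: (@leq_trans (2 ^ x * 2 ^ (b * size s).+1)).
  by rewrite ltn_pmul2l ?expn_gt0 // expnS -mul2n; lia.
by rewrite expnS mulnA -expnSr leq_pmul2r ?expn_gt0 // leq_exp2l.
Qed.

Section Pumping.
Variables (A : eqType) (M : nfa A) (K : nat).
Hypothesis trans_ltn : forall t, t \in nfa_trans M -> t.2 < K.

Definition same_states (u v : seq A) := forall p, p < K ->
  nfa_accepts_from M p u = nfa_accepts_from M p v.

Lemma same_states_cat x u v : same_states u v -> same_states (x ++ u) (x ++ v).
Proof.
move=> uv; elim: x => //= a x IHx p _ /=.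
by apply: eq_in_has => t /trans_ltn lt_t; rewrite (IHx _ lt_t).
Qed.

(** Acceptance from the states below [K] is a vector of [K] bits, so two of the [2 ^ K + 1] words
    [nseq i a ++ y] share it. Prepending letters acts on these vectors, so they are periodic from
    [i] on; the period [j - i] is at most [2 ^ K] and divides the factorial. *)
Lemma pump_nseq a y d : (2 ^ K)`! %| d ->
  same_states (nseq (2 ^ K + d) a ++ y) (nseq (2 ^ K) a ++ y).
Proof.
move=> dvd_d.
pose B (i : 'I_(2 ^ K).+1) :=
  [ffun p : 'I_K => nfa_accepts_from M p (nseq i a ++ y)].
have /injectivePn [i [j ne_ij eqB]] : ~~ injectiveb B.
  apply/negP => /injectiveP /leq_card.
  by rewrite card_ffun card_bool !card_ord ltnn.
wlog lt_ij : i j ne_ij eqB / i < j.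
  move=> wl; case: (ltngtP i j) => [lt|lt|eq_ij]; first exact: wl lt.
    by apply: wl lt; rewrite 1?eq_sym.
  by case/eqP: ne_ij; apply: val_inj.
have same_ij : same_states (nseq j a ++ y) (nseq i a ++ y).
  by move=> p lt_p; have /ffunP /(_ (Ordinal lt_p)) := eqB; rewrite !ffunE.
have period m : i <= m -> same_states (nseq (m + (j - i)) a ++ y) (nseq m a ++ y).
  move=> le_im; have -> : m + (j - i) = m - i + j by lia.
  rewrite -{2}(subnK le_im) !nseqD -!catA; exact: same_states_cat.
have lt_i := ltn_ord i; have lt_j := ltn_ord j.
have /dvdnP [k ->] : j - i %| d.
  by apply: dvdn_trans dvd_d; apply: dvdn_fact; lia.
elim: k => [|k IHk] p lt_p; first by rewrite mul0n addn0.
rewrite mulSn [_ + k * _]addnC addnA period //; first exact: IHk.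
by lia.
Qed.

End Pumping.

(** * Convolutions of words over one letter *)

Section Words.
Variable r : nat.

Definition word_letter (v : nat -> nat) (j : nat) : letter unit r :=
  [tuple if j < v i then Some tt else None | i < r].

Definition word (v : nat -> nat) : seq (letter unit r) :=
  mkseq (word_letter v) (\max_(i < r) v i).

Lemma onth_unit (w : seq unit) j : onth w j = if j < size w then Some tt else None.
Proof. by elim: w j => [|[] w IHw] [|j] //=; rewrite IHw. Qed.

Lemma conv_word (ws : r.-tuple (seq unit)) :
  conv ws = word (fun i => size (nth [::] ws i)).
Proof.
rewrite /conv /word; under eq_bigr do rewrite (tnth_nth [::]).
apply: eq_mkseq => j; apply: eq_from_tnth => i.
by rewrite !tnth_mktuple onth_unit (tnth_nth [::]).
Qed.

Lemma eq_word u v : (forall i, i < r -> u i = v i) -> word u = word v.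
Proof.
move=> uv; rewrite /word; under eq_bigr do rewrite uv //.
apply: eq_mkseq => j; apply: eq_from_tnth => i.
by rewrite !tnth_mktuple uv.
Qed.

Lemma leq_word v i : i < r -> v i <= size (word v).
Proof.
move=> lt_i; rewrite size_mkseq.
exact: (leq_bigmax (F := fun i : 'I_r => v i) (Ordinal lt_i)).
Qed.

Lemma code_letter_nth v j i : i < r ->
  nth 0 (CodeSeq.decode (code_letter (word_letter v j))) i = (j < v i).
Proof.
move=> lt_i; rewrite CodeSeq.codeK (nth_map None) ?size_tuple //.
rewrite -(tnth_nth _ _ (Ordinal lt_i)) tnth_mktuple /=.
by case: ifP.
Qed.

(** Each length is recovered by counting the letters whose bit is set. The program measures words in
    this way, and [word_inj] follows. *)
Lemma track_word v i : i < r ->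
  \sum_(0 <= j < size (word v)) nth 0 (CodeSeq.decode
    (nth 0 [seq code_letter a | a <- word v] j)) i = v i.
Proof.
move=> lt_i.
have bit j : j < size (word v) ->
    nth 0 (CodeSeq.decode (nth 0 [seq code_letter a | a <- word v] j)) i = (j < v i).
  move=> lt_j; rewrite (nth_map (word_letter v 0)) //.
  by move: lt_j; rewrite size_mkseq => lt_j; rewrite nth_mkseq // code_letter_nth.
rewrite (eq_big_nat _ _ (F2 := fun j => (j < v i) : nat)) => [|j /andP [_ /bit]] //.
by rewrite sum_ltn; apply/minn_idPr/leq_word.
Qed.

Lemma word_inj u v : word u = word v -> forall i, i < r -> u i = v i.
Proof. by move=> uv i lt_i; rewrite -(track_word u) // uv track_word. Qed.

Lemma mkseqD T (f : nat -> T) m n :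
  mkseq f (m + n) = mkseq f m ++ mkseq (fun j => f (m + j)) n.
Proof. by rewrite /mkseq iotaD map_cat add0n -[m in iota m n]addn0 iotaDl -map_comp. Qed.

Lemma mkseq_const T (f : nat -> T) a n :
  (forall j, j < n -> f j = a) -> mkseq f n = nseq n a.
Proof.
move=> fa; apply: (eq_from_nth (x0 := a)); first by rewrite size_mkseq size_nseq.
by move=> j; rewrite size_mkseq => lt_j; rewrite nth_mkseq // nth_nseq lt_j fa.
Qed.

(** The gap is a block of equal letters, and translating the components above it by [d] inserts [d]
    more copies; the last hypothesis makes the word reach across the gap. *)
Lemma word_gap v g N d : 0 < N -> has_gap r v g N -> g < \max_(i < r) v i ->
  exists x a y, word v = x ++ nseq N a ++ y /\
    word (shift g d \o v) = x ++ nseq (N + d) a ++ y.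
Proof.
move=> N_gt0 gap lt_g.
have r_gt0 : 0 < #|'I_r|.
  rewrite card_ord lt0n; apply: contraTneq lt_g => r0.
  by rewrite big1 // => i _; have := ltn_ord i; rewrite {2}r0.
(* A longest component lies above the gap and fixes the lengths of both words. *)
have [i0 max_v] := eq_bigmax (fun i : 'I_r => v i) r_gt0.
have le_v (i : 'I_r) : v i <= v i0.
  by rewrite -max_v; apply: (leq_bigmax (F := fun i : 'I_r => v i)).
have gap0 : g + N <= v i0 by move: lt_g (gap i0 (ltn_ord i0)); rewrite max_v; lia.
have max_shift : \max_(i < r) (shift g d \o v) i = v i0 + d.
  apply/eqP; rewrite eqn_leq; apply/andP; split.
    apply/bigmax_leqP => i _ /=; have := le_v i.
    by rewrite /shift; case: ifP; lia.
  have -> : v i0 + d = (shift g d \o v) i0 by rewrite /shift /= ifN //; lia.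
  exact: (leq_bigmax (F := fun i : 'I_r => (shift g d \o v) i)).
pose s := v i0 - (g + N).
exists (mkseq (word_letter v) g), (word_letter v g),
  (mkseq (fun j => word_letter v (g + (N + j))) s).
split.
  rewrite /word max_v (_ : v i0 = g + (N + s)); last by rewrite /s; lia.
  rewrite 2!mkseqD; congr (_ ++ (_ ++ _)); apply: mkseq_const => j lt_j.
  apply: eq_from_tnth => i; rewrite !tnth_mktuple.
  by congr (if _ then _ else _); have := gap i (ltn_ord i); lia.
rewrite /word max_shift (_ : v i0 + d = g + (N + d + s)); last by rewrite /s; lia.
rewrite 2!mkseqD; congr (_ ++ (_ ++ _)).
- apply/eq_in_map => j; rewrite mem_iota => lt_j.
  apply: eq_from_tnth => i; rewrite !tnth_mktuple.
  by congr (if _ then _ else _); rewrite /shift /=; case: ifP => //; lia.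
- apply: mkseq_const => j lt_j; apply: eq_from_tnth => i; rewrite !tnth_mktuple.
  congr (if _ then _ else _); have := gap i (ltn_ord i).
  by rewrite /shift /=; case: ifP; lia.
- apply: eq_mkseq => j; apply: eq_from_tnth => i; rewrite !tnth_mktuple.
  by congr (if _ then _ else _); rewrite /shift /=; case: ifP; lia.
Qed.

End Words.

(** * Runs as numbers *)

Local Notation "c ._[ i ]" := (nth 0 (CodeSeq.decode c) i)
  (at level 2, i at level 200, left associativity, format "c ._[ i ]").

Lemma nth_code s i : (CodeSeq.code s)._[i] = nth 0 s i.
Proof. by rewrite CodeSeq.codeK. Qed.

Section CodedRuns.
Variables (r : nat) (M : nfa (letter unit r)).

Definition is_step (y y' z : nat) :=
  [&& z \in [seq code_trans t | t <- nfa_trans M], z._[0] == y & z._[2] == y'].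

Lemma accepts_of_run (y z : nat -> nat) L :
  (forall j, j < L -> is_step (y j) (y j.+1) (z j)) -> y L \in nfa_final M ->
  exists u, [/\ size u = L, nfa_accepts_from M (y 0) u &
    forall j, j < L -> (z j)._[1] = nth 0 [seq code_letter a | a <- u] j].
Proof.
elim: L y z => [|L IHL] y z steps final; first by exists [::].
have [j lt_j|//|u [size_u acc_u letters]] := IHL (y \o succn) (z \o succn).
  exact: steps.
have /and3P [/mapP [t Mt eq_z] /eqP y0 /eqP y1] := steps 0 isT.
move: y0 y1; rewrite eq_z !nth_code /= => y0 y1.
exists (t.1.2 :: u); split; first by rewrite /= size_u.
  apply/hasP; exists t => //; rewrite y0 !eqxx /= y1; exact: acc_u.
by case=> [|j] lt_j /=; [rewrite eq_z nth_code | apply: letters].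
Qed.

Lemma run_of_accepts p u : nfa_accepts_from M p u ->
  exists y z, [/\ size y = size u, size z = size u,
    (forall j, j < size u -> is_step (nth 0 (p :: y) j) (nth 0 y j) (nth 0 z j)),
    last p y \in nfa_final M &
    forall j, (nth 0 z j)._[1] = nth 0 [seq code_letter a | a <- u] j].
Proof.
elim: u p => [|a u IHu] p /=.
  by move=> final; exists [::], [::]; split=> // j; rewrite !nth_nil.
case/hasP => t Mt /and3P [/eqP tp /eqP ta].
case/IHu => y [z [size_y size_z steps final letters]].
exists (t.2 :: y), (code_trans t :: z); split=> //=; rewrite ?size_y ?size_z //.
  case=> [|j] lt_j /=; last exact: steps.
  by rewrite /is_step map_f // !nth_code /= tp !eqxx.
by case=> [|j] //=; rewrite nth_code /= ta.
Qed.

(** Entries of a list are smaller than its code, so [code_nfa M] bounds initial states, targets and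
    coded transitions, and can stand in for the number of states. *)
Lemma init_ltn p : p \in nfa_init M -> p < code_nfa M.
Proof.
move/mem_ltn_code => lt_p; apply: ltn_trans lt_p _.
by rewrite mem_ltn_code ?inE ?eqxx.
Qed.

Lemma code_trans_ltn t : t \in nfa_trans M -> code_trans t < code_nfa M.
Proof.
move=> Mt; apply: (@ltn_trans (CodeSeq.code [seq code_trans t | t <- nfa_trans M])).
  by rewrite mem_ltn_code // map_f.
by rewrite mem_ltn_code ?inE ?eqxx ?orbT.
Qed.

Lemma trans_target_ltn t : t \in nfa_trans M -> t.2 < code_nfa M.
Proof.
move/code_trans_ltn; apply: ltn_trans.
by rewrite mem_ltn_code ?inE ?eqxx ?orbT.
Qed.

Lemma is_step_ltn y y' z : is_step y y' z -> y' < code_nfa M /\ z < code_nfa M.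
Proof.
case/and3P => /mapP [t Mt ->] _ /eqP <-; rewrite nth_code /=.
by rewrite trans_target_ltn ?code_trans_ltn.
Qed.

(** By [word_gap] the shift lengthens a block of [N] equal letters by [d], which no state detects by
    [pump_nseq]; if no component lies above the gap, the word is unchanged. *)
Lemma nfa_lang_shift K v g d N : code_nfa M <= K -> N = 2 ^ K -> N`! %| d ->
  has_gap r v g N -> nfa_lang M (word r v) <-> nfa_lang M (word r (shift g d \o v)).
Proof.
move=> le_K eqN dvd_d gap.
have [le_g|lt_g] := leqP (\max_(i < r) v i) g.
  suff -> : word r (shift g d \o v) = word r v by split.
  apply: eq_word => i lt_i; rewrite /shift /= (leq_trans _ le_g) //.
  exact: (leq_bigmax (F := fun i : 'I_r => v i) (Ordinal lt_i)).
have N_gt0 : 0 < N by rewrite eqN expn_gt0.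
have [x [a [y [-> ->]]]] := word_gap d N_gt0 gap lt_g.
have trans_K t : t \in nfa_trans M -> t.2 < K.
  by move=> /trans_target_ltn lt_t; apply: leq_trans le_K.
suff -> : nfa_lang M (x ++ nseq (N + d) a ++ y) = nfa_lang M (x ++ nseq N a ++ y) by split.
congr is_true; apply: eq_in_has => p /init_ltn lt_p.
have lt_pK := leq_trans lt_p le_K.
apply: (same_states_cat trans_K) lt_pK; subst N; exact: (pump_nseq trans_K).
Qed.

End CodedRuns.

(** * From the presentation to rules on numbers *)

Section Presentation.
Variables (n : nat) (ar : 'I_n -> nat) (S : Type) (op : algebra S ar).
Variables (phi : seq unit -> S) (D : rel_automata unit (fun i => (ar i).+1)).

Let r := ar_eq (fun i => (ar i).+1).

(** Equality, at index [None], is a rule as well: it passes from one representative of an element to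
    another. *)
Definition rule (o : option 'I_n) (v : nat -> nat) : Prop :=
  @nfa_lang ((r o).-tuple (option unit)) (D o) (word (r o) v).

Lemma arity_gt0 o : 0 < r o.
Proof. by case: o. Qed.

Lemma mem_code_automata e :
  e \in CodeSeq.decode (code_automata D) <->
  exists o, e = CodeSeq.code [:: r o; code_nfa (D o)].
Proof.
rewrite CodeSeq.codeK; split; first by case/mapP => o _ ->; exists o.
case=> o ->; apply: (map_f (fun o => CodeSeq.code [:: r o; code_nfa (D o)])).
by case: o => [i|]; rewrite ?mem_head // inE map_f ?mem_enum ?orbT.
Qed.

(** One number read off the input thus exceeds all arities and automaton codes, and supplies the
    constants for every rule at once. *)
Lemma entry_ltn o : CodeSeq.code [:: r o; code_nfa (D o)] < code_automata D.
Proof.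
rewrite mem_ltn_code // -[X in _ \in X]CodeSeq.codeK.
by apply/mem_code_automata; exists o.
Qed.

Lemma arity_ltn o : r o < code_automata D.
Proof. by apply: ltn_trans (entry_ltn o); rewrite mem_ltn_code ?inE ?eqxx. Qed.

Lemma code_nfa_ltn o : code_nfa (D o) < code_automata D.
Proof. by apply: ltn_trans (entry_ltn o); rewrite mem_ltn_code ?inE ?eqxx ?orbT. Qed.

Lemma rule_ext o u v : (forall i, i < r o -> u i = v i) -> rule o u -> rule o v.
Proof. by move=> uv; rewrite /rule (eq_word uv). Qed.

Let N := 2 ^ code_automata D.

Lemma rule_shift o v g d : N`! %| d -> has_gap (r o) v g N ->
  rule o v <-> rule o (shift g d \o v).
Proof.
move=> dvd_d gap; apply: (nfa_lang_shift (K := code_automata D)) gap => //.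
exact/ltnW/code_nfa_ltn.
Qed.

Hypothesis pres : fa_presentation (graph_structure op) setT phi.
Hypothesis recog : recognize_presentation (graph_structure op) setT phi D.

Lemma nseq_unit (w : seq unit) : w = nseq (size w) tt.
Proof. by elim: w => //= -[] w {1}->. Qed.

Lemma ruleP o v : rule o v <->
  rel_eq (graph_structure op) o [tuple phi (nseq (v i) tt) | i < r o].
Proof.
rewrite /rule recog; split=> [[ws [_ Rws] eq_ws]|Rv].
  suff -> : [tuple phi (nseq (v i) tt) | i < r o] = map_tuple phi ws by [].
  apply: eq_from_tnth => i; rewrite tnth_mktuple tnth_map.
  move: eq_ws; rewrite conv_word => /word_inj /(_ i (ltn_ord i)) <-.
  by rewrite -nseq_unit (tnth_nth [::]).
exists [tuple nseq (v i) tt | i < r o].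
  split=> //; suff -> : map_tuple phi [tuple nseq (v i) tt | i < r o] =
    [tuple phi (nseq (v i) tt) | i < r o] by [].
  by apply: eq_from_tnth => i; rewrite tnth_map !tnth_mktuple.
rewrite conv_word; apply: eq_word => i lt_i.
by rewrite -(tnth_nth _ _ (Ordinal lt_i)) tnth_mktuple size_nseq.
Qed.

(* The program need not check that the words it reads are convolutions. *)
Lemma accepted_word o u : nfa_lang (D o) u -> exists v, u = word (r o) v.
Proof.
by rewrite recog => -[ws _ <-]; rewrite conv_word; eexists; reflexivity.
Qed.

Lemma tnth_rcons T k (x : k.-tuple T) y (i : 'I_k.+1) (j : 'I_k) : i = j :> nat ->
  tnth [tuple of rcons x y] i = tnth x j.
Proof. by move=> ij; rewrite !(tnth_nth y) /= nth_rcons size_tuple ij ltn_ord. Qed.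

Lemma tnth_rcons_last T k (x : k.-tuple T) y (i : 'I_k.+1) : i = k :> nat ->
  tnth [tuple of rcons x y] i = y.
Proof. by move=> ik; rewrite (tnth_nth y) /= nth_rcons size_tuple ik ltnn eqxx. Qed.

(** The numbers representing elements of the subalgebra are closed under the rules. Conversely, the
    elements all of whose representatives lie in the closure form a subalgebra containing the
    generators. *)
Lemma generated_closure (X : seq (seq unit)) m :
  generated op (phi @` [set x | x \in X]) (phi (nseq m tt)) <->
  rule_closure r rule [seq size x | x <- X] m.
Proof.
set T := generated op _; split=> [Tm|]; last first.
  move=> clm.
  apply: (clm (fun m => T (phi (nseq m tt)))) => [o v|_ /mapP [x Xx ->]]; last first.
    by move=> U [_ subU]; apply: subU; exists x; rewrite // -nseq_unit.
  move/ruleP; case: o => [i|] /=.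
    case=> x eq_x args U [clU subU].
    have tnth_x (j : 'I_(ar i).+1) :
        tnth [tuple of rcons x (op x)] j = phi (nseq (v j) tt).
      by rewrite -eq_x tnth_mktuple.
    rewrite -(tnth_x ord_max) tnth_rcons_last //; apply: (clU _ x) => j.
    rewrite -(tnth_rcons x (op x) (i := lift ord_max j)) ?lift_max // tnth_x lift_max.
    by apply: (args j (ltn_ord j)); split.
  move=> eq_v args; have : tnth [tuple phi (nseq (v i) tt) | i < 2] ord0 =
    tnth [tuple phi (nseq (v i) tt) | i < 2] ord_max := eq_v.
  by rewrite !tnth_mktuple /= => <-; apply: (args 0).
pose U s := forall m, phi (nseq m tt) = s -> rule_closure r rule [seq size x | x <- X] m.
apply: (Tm U) => //; split=> [i x args k phik|s [x Xx <-] k phik].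
  (* Surjectivity of [phi] provides representatives of the arguments. *)
  have /choice [w wP] j : exists w, phi w = tnth x j.
    have : (phi @` setT)%classic (tnth x j) by rewrite (fap_surj pres).
    by case=> w _ phiw; exists w.
  pose v j := if insub j is Some j' then size (w j') else k.
  have v_arg (j : 'I_(ar i)) : v j = size (w j) by rewrite /v valK.
  have v_last : v (ar i) = k by rewrite /v insubN // ltnn.
  rewrite -v_last; apply: (@rule_closure_closed _ r rule _ (Some i) v) => [|j lt_j].
    apply/ruleP; exists x; apply: eq_from_tnth => j; rewrite tnth_mktuple.
    have [lt_j|ge_j] := ltnP j (ar i).
      rewrite (tnth_rcons _ _ (j := Ordinal lt_j)) // -wP.
      by rewrite (v_arg (Ordinal lt_j)) -nseq_unit.
    have eq_j : j = ar i :> nat by apply/eqP; rewrite eqn_leq ge_j andbT -ltnS.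
    by rewrite tnth_rcons_last // eq_j v_last.
  by rewrite (v_arg (Ordinal lt_j)); apply: (args (Ordinal lt_j)); rewrite -nseq_unit wP.
(* The equality rule leads from the given word of a generator to its arbitrary representative
   [k]. *)
pose v j := if j == 0 then size x else k.
rewrite -[k]/(v 1); apply: (@rule_closure_closed _ r rule _ None v) => [|j].
  by apply/ruleP; rewrite /= !tnth_mktuple /= phik -nseq_unit.
by rewrite ltnS leqn0 => /eqP -> F _; apply; apply: map_f.
Qed.

End Presentation.

(** * The decision procedure *)

(* [c] is the code of an automaton, and [y] and [z] are the codes of the lists of
   states and of transitions of a run of length [L]. *)
Definition accepting_run (c L y z : nat) :=
  [&& y._[0] \in CodeSeq.decode c._[0], y._[L] \in CodeSeq.decode c._[1] &
      all (fun j => [&& z._[j] \in CodeSeq.decode c._[2],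
             z._[j]._[0] == y._[j] & z._[j]._[2] == y._[j.+1]]) (iota 0 L)].

(* Bit [i] of a letter is 1 exactly as long as the [i]-th word lasts, so the sum
   is the length of that word. *)
Definition track (L z i : nat) := \sum_(0 <= j < L) z._[j]._[1]._[i].

(* The mask [f] codes a list whose nonzero entries mark a set of naturals, and [e]
   is the code of an arity and an automaton. *)
Definition entry_closed (e f L y z : nat) :=
  accepting_run e._[1] L y z &&
    all (fun i => f._[track L z i] != 0) (iota 0 e._[0].-1) ==>
  (f._[track L z e._[0].-1] != 0).

(** A tuple below [n] is read by a run of length [L < n], with at most [n] states, all states and
    transitions being below [c]; [code_bound] gives the search bound [2 ^ (c * n)]. *)
Definition mask_closed (c n f : nat) :=
  all (fun e => all (fun L => all (fun y => all (fun z =>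
      entry_closed e f L y z)
    (iota 0 (2 ^ (c * n)))) (iota 0 (2 ^ (c * n)))) (iota 0 n))
  (CodeSeq.decode c).

Definition mask_contains (s f : nat) := all (fun x => f._[x] != 0) (CodeSeq.decode s).

(** The condition [s <= n] puts the generators below [n]; lists of [n] bits have codes below
    [2 ^ (2 * n)]. *)
Definition certified_in (c s w n : nat) :=
  [&& s <= n, w < n & all (fun f => mask_contains s f && mask_closed c n f ==>
    (f._[w] != 0)) (iota 0 (2 ^ (2 * n)))].

Definition mask_periodic (n h d f : nat) :=
  all (fun x => (h <= x) && (x + d < n) ==>
    ((f._[x] != 0) == (f._[x + d] != 0))) (iota 0 n).

(** Here [c], [2 ^ c] and the factorial of [2 ^ c] are the [K], [N] and [p] of
    [rule_closed_below_extend]. *)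
Definition certified_out (c s w n : nat) :=
  [&& s <= n, w < n & has (fun h => has (fun d =>
    [&& 0 < d, (2 ^ c)`! %| d, h + c.+1 * (2 ^ c + d) <= n &
      has (fun f => [&& mask_contains s f, mask_closed c n f, f._[w] == 0 &
        mask_periodic n h d f]) (iota 0 (2 ^ (2 * n)))])
    (iota 0 n)) (iota 0 n)].

Ltac compute_step := first
  [ var
  | apply: computable_dvd | apply: computable_all_iota | apply: computable_has_iota
  | apply: computable_all | apply: computable_sum
  | apply: computable_and | apply: computable_or | apply: computable_implies
  | apply: computable_neg | apply: computable_eqb | apply: computable_leq
  | apply: computable_eqn | apply: computable_mem
  | apply: computable_nth | apply: computable_size | apply: computable_exp2
  | apply: computable_fact | apply: computable_const
  | apply: computable_add | apply: computable_mul | apply: computable_sub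
  | apply: computable_pred | apply: computableS ].


Lemma computable_certified_in :
  computable (bind [:: (fun e : nat * nat * nat => e.1.1); (fun e => e.1.2); snd])
    (fun u => certified_in u.1.1.1 u.1.1.2 u.1.2 u.2).
Proof.
rewrite /certified_in /mask_contains /mask_closed /entry_closed /accepting_run /track.
repeat compute_step.
Qed.

Lemma computable_certified_out :
  computable (bind [:: (fun e : nat * nat * nat => e.1.1); (fun e => e.1.2); snd])
    (fun u => certified_out u.1.1.1 u.1.1.2 u.1.2 u.2).
Proof.
rewrite /certified_out /mask_periodic /mask_contains /mask_closed /entry_closed.
rewrite /accepting_run /track.
repeat compute_step.
Qed.

(** * Soundness and completeness of the certificates *)

Section Correctness.
Variables (n : nat) (ar : 'I_n -> nat) (S : Type) (op : algebra S ar).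
Variables (phi : seq unit -> S) (D : rel_automata unit (fun i => (ar i).+1)).
Hypothesis recog : recognize_presentation (graph_structure op) setT phi D.

Let r := ar_eq (fun i => (ar i).+1).
Let K := code_automata D.
Let marked f x := f._[x] != 0 : Prop.

Lemma accepting_run_word o (L y z : nat) : accepting_run (code_nfa (D o)) L y z ->
  exists v, [/\ rule D o v, size (word (r o) v) = L &
    forall i, i < r o -> track L z i = v i].
Proof.
rewrite /accepting_run !nth_code !CodeSeq.codeK => /and3P [init final /allP steps].
have [j lt_j|//|u [size_u acc letters]] :=
  @accepts_of_run _ (D o) (nth 0 (CodeSeq.decode y)) (nth 0 (CodeSeq.decode z)) L.
  by apply: steps; rewrite mem_iota.
have lang_u : nfa_lang (D o) u by apply/hasP; exists y._[0].
have [v eq_u] := accepted_word recog lang_u.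
move: size_u lang_u letters {acc}; rewrite eq_u => <- Rv letters.
exists v; split=> // i lt_i; rewrite -[RHS](track_word v lt_i).
by apply: eq_big_nat => j /andP [_ /letters ->].
Qed.

Lemma rule_run o v : rule D o v -> exists y z,
  [/\ y < 2 ^ (K * (size (word (r o) v)).+1), z < 2 ^ (K * size (word (r o) v)),
    accepting_run (code_nfa (D o)) (size (word (r o) v)) y z &
    forall i, i < r o -> track (size (word (r o) v)) z i = v i].
Proof.
case/hasP => p init /run_of_accepts [y [z [size_y size_z steps final letters]]].
set L := size (word _ v) in size_y size_z steps *.
have lt_K := ltnW (code_nfa_ltn D o).
exists (CodeSeq.code (p :: y)), (CodeSeq.code z); split.
- rewrite -size_y; apply: (@code_bound K (p :: y)) => /=.
  rewrite (leq_trans (init_ltn init)) //=.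
  apply/(all_nthP 0) => j; rewrite size_y => /steps /is_step_ltn [lt_y _].
  exact: leq_trans lt_y lt_K.
- rewrite -size_z; apply: code_bound.
  apply/(all_nthP 0) => j; rewrite size_z => /steps /is_step_ltn [_ lt_z].
  exact: leq_trans lt_z lt_K.
- rewrite /accepting_run !nth_code !CodeSeq.codeK init /= -size_y nth_last /= final.
  by apply/allP => j; rewrite mem_iota size_y => /steps.
- move=> i lt_i; rewrite -[RHS](track_word v lt_i).
  by apply: eq_big_nat => j _; rewrite nth_code letters.
Qed.

Lemma mask_closedP m f : mask_closed K m f <-> rule_closed_below r (rule D) m (marked f).
Proof.
split=> [/allP clf o v Rv lt_v args|clf].
  have [y [z [lt_y lt_z run tr]]] := rule_run Rv.
  set L := size (word _ v) in lt_y lt_z run tr.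
  have lt_L : L < m.
    have lt_0 := lt_v 0 (arity_gt0 ar o).
    rewrite /L size_mkseq -(ltn_predK lt_0) ltnS; apply/bigmax_leqP => i _.
    by have := lt_v i (ltn_ord i); lia.
  have De : CodeSeq.code [:: r o; code_nfa (D o)] \in CodeSeq.decode K.
    by apply/mem_code_automata; exists o.
  have /allP /(_ L) := clf _ De; rewrite mem_iota => /(_ lt_L).
  have bound k : k <= m -> 2 ^ (K * k) <= 2 ^ (K * m).
    by move=> le_k; rewrite leq_exp2l // leq_mul2l le_k orbT.
  move=> /allP /(_ y); rewrite mem_iota => /(_ (leq_trans lt_y (bound _ lt_L))).
  move=> /allP /(_ z); rewrite mem_iota => /(_ (leq_trans lt_z (bound _ (ltnW lt_L)))).
  rewrite /entry_closed !nth_code /= run /= (tr _ (last_lt (@arity_gt0 _ ar) o)).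
  move/implyP; apply; apply/allP => i; rewrite mem_iota => lt_i.
  by rewrite tr; [apply: args | have := arity_gt0 ar o; rewrite -/r; lia].
apply/allP => e /mem_code_automata [o ->].
apply/allP => L; rewrite mem_iota => lt_L; apply/allP => y _; apply/allP => z _.
apply/implyP; rewrite !nth_code /=.
case/andP => /accepting_run_word [v [Rv size_w tr]] /allP args.
have lt_r : (r o).-1 < r o := last_lt (@arity_gt0 _ ar) o.
rewrite tr //; apply: (clf o v Rv) => i lt_i.
  by apply: leq_ltn_trans (leq_word v lt_i) _; rewrite size_w.
rewrite /marked -tr; last by lia.
by apply: args; rewrite mem_iota.
Qed.
Let N_gt0 : 0 < 2 ^ K. Proof. by rewrite expn_gt0. Qed.

Let extend m h d F := @rule_closed_below_extend _ r (rule D) K (2 ^ K) (2 ^ K)`!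
  (@arity_gt0 _ ar) (fun o => ltnW (arity_ltn D o)) N_gt0 (fact_gt0 _)
  (@rule_ext _ _ D) (@rule_shift _ _ D) m h d F.

Let periodic := @rule_closure_periodic _ r (rule D) K (2 ^ K) (2 ^ K)`!
  (@arity_gt0 _ ar) (fun o => ltnW (arity_ltn D o)) N_gt0 (fact_gt0 _)
  (@rule_shift _ _ D).

Lemma exists_mask m (F : nat -> Prop) : exists2 f, f < 2 ^ (2 * m) &
  (forall x, x < m -> marked f x <-> F x) /\ forall x, marked f x -> x < m.
Proof.
pose s := mkseq (fun x => nat_of_bool `[< F x >]) m.
exists (CodeSeq.code s).
  have := @code_bound 2 s; rewrite size_mkseq; apply.
  by apply/allP => _ /mapP [x _ ->]; case: asboolP.
rewrite /marked CodeSeq.codeK; split=> x.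
  by move=> lt_x; rewrite nth_mkseq //; case: asboolP; split.
by rewrite ltnNge; apply: contra => le_x; rewrite nth_default ?size_mkseq.
Qed.

Variable X : seq (seq unit).
Let s := code_words X.
Let C := rule_closure r (rule D) [seq size x | x <- X].

Lemma mask_containsP f :
  mask_contains s f <-> forall x, x \in [seq size x | x <- X] -> marked f x.
Proof. by rewrite /mask_contains CodeSeq.codeK; split=> /allP. Qed.

(** The closure itself, cut off at [m], is among the masks tested. *)
Lemma certified_in_sound w m : certified_in K s w m -> C w.
Proof.
case/and3P => le_sm lt_wm /allP cert.
have [f lt_f [fC lt_m]] := exists_mask m C.
apply/(fC _ lt_wm); have := cert f; rewrite mem_iota => /(_ lt_f) /implyP; apply.
apply/andP; split.
  apply/mask_containsP => x Xx; apply/fC; last by move=> F _; apply.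
  exact: leq_trans (mem_ltn_code Xx) le_sm.
apply/mask_closedP => o v Rv lt_v args.
have lt_r := last_lt (@arity_gt0 _ ar) o.
apply/fC; first exact: lt_v.
apply: (@rule_closure_closed _ r _ _ o) => // i lt_i.
by apply/fC; [apply: lt_v; lia | apply: args].
Qed.

(** The periodic extension of the mask is a closed set containing the generators but not [w]. *)
Lemma certified_out_sound w m : certified_out K s w m -> ~ C w.
Proof.
case/and3P => le_sm lt_wm /hasP [h _ /hasP [d _ /and4P [d_gt0 dvd_d le_m]]].
case/hasP => f _ /and4P [/mask_containsP subf /mask_closedP clf /eqP fw0 /allP perf].
have perf' x : h <= x -> x + d < m -> marked f x <-> marked f (x + d).
  move=> le_x lt_x; have lt_xm : x < m by lia.
  have := perf x; rewrite mem_iota lt_xm le_x lt_x /marked => /(_ isT) /eqP ->.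
  by split.
have [G clG GF] := extend d_gt0 dvd_d le_m clf perf'.
move=> Cw; have : marked f w.
  apply/(GF _ lt_wm); apply: (Cw G clG) => x Xx.
  have lt_xm : x < m := leq_trans (mem_ltn_code Xx) le_sm.
  exact/(GF _ lt_xm)/subf.
by rewrite /marked fw0.
Qed.

Lemma certified_in_complete w : C w -> exists m, certified_in K s w m.
Proof.
move=> /rule_closure_bounded [m0 m0P].
exists (m0 + s + w.+1); apply/and3P; split; [lia | lia |].
apply/allP => f _; apply/implyP => /andP [/mask_containsP subf /mask_closedP clf].
by apply: (m0P _ (marked f) _ clf subf); lia.
Qed.

Lemma certified_out_complete w : ~ C w -> exists m, certified_out K s w m.
Proof.
move=> nCw; have [h [d [d_gt0 dvd_d perC]]] := periodic [seq size x | x <- X].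
(* [b] is the length demanded for the periodic extension; the other summands put the generators, [w]
   and [d] below [m]. The mask is the closure cut off at [m]. *)
pose b := h + K.+1 * (2 ^ K + d); pose m := b + s + w.+1 + d.+1.
have [f lt_f [fC lt_m]] := exists_mask m C.
have fC' : forall x, marked f x -> C x by move=> x fx; apply/fC => //; apply: lt_m.
exists m; apply/and3P; split; [by rewrite /m; lia | by rewrite /m; lia |].
apply/hasP; exists h; first by rewrite mem_iota /m /b; lia.
apply/hasP; exists d; first by rewrite mem_iota /m /b; lia.
apply/and4P; split=> //; first by rewrite -/b /m; lia.
apply/hasP; exists f; first by rewrite mem_iota.
apply/and4P; split.
- apply/mask_containsP => x Xx; apply/fC; last by move=> F _; apply.
  have lt_x : x < s := mem_ltn_code Xx.
  by rewrite /m; lia.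
- apply/mask_closedP => o v Rv lt_v args; apply/fC; first exact/lt_v/last_lt/arity_gt0.
  apply: (@rule_closure_closed _ r _ _ o) => // i lt_i; exact: fC' (args i lt_i).
- by apply/negPn/negP => /fC'.
- apply/allP => x _; apply/implyP => /andP [le_x lt_x].
  have lt_xm : x < m by lia.
  apply/eqP; apply/idP/idP => /fC' Cx.
    by apply/(fC _ lt_x); apply/(perC _ le_x).
  by apply/(fC _ lt_xm); apply/(perC _ le_x).
Qed.

End Correctness.

(** [Mu] looks for a zero, so it is run on the negation of [P]; its result becomes the bound
    variable of [Q]. *)
Lemma eval_search E vars (P Q : E * nat -> bool) :
  computable (bind vars) P -> computable (bind vars) Q ->
  exists c, forall e, (exists m, P (e, m)) ->
    exists2 m, P (e, m) & eval c [seq v e | v <- vars] (Q (e, m)).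
Proof.
move=> /computable_neg [cP PP] [cQ QQ].
exists (Comp cQ (Mu cP :: [seq Proj i | i <- iota 0 (size vars)])) => e exP.
case: (ex_minnP exP) => m Pm min_m; exists m => //.
apply: eval_comp; last by have := QQ (e, m); rewrite map_bind; apply.
apply: evals_cons.
  apply: eval_mu => [k lt_k|]; last first.
    by have := PP (e, m); rewrite map_bind Pm.
  have := PP (e, k); rewrite map_bind; case Pk : (P (e, k)); last by exists 0.
  by have := min_m k Pk; rewrite leqNgt lt_k.
have := evals_projs 0 [seq v e | v <- vars].
by rewrite drop0 subn0 size_map; apply.
Qed.

Local Open Scope classical_set_scope.

Theorem theorem5p3 :
  exists c : recfun,
    forall (n : nat) (ar : 'I_n -> nat) (S : Type) (op : algebra S ar)
           (phi : seq unit -> S)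
           (D : rel_automata unit (fun i => (ar i).+1))
           (X : seq (seq unit)) (w : seq unit),
      fa_presentation (graph_structure op) setT phi ->
      recognize_presentation (graph_structure op) setT phi D ->
      exists b : bool,
        eval c [:: code_automata D; code_words X; size w] (nat_of_bool b) /\
        (b <-> generated op (phi @` [set x | x \in X]) (phi w)).
Proof.
(* The search stops at a certificate of either kind, and the output tells whether it certifies
   membership. *)
have [c cP] := eval_search
  (computable_or computable_certified_in computable_certified_out)
  computable_certified_in.
exists c => n ar S op phi D X w pres recog.
rewrite [w in phi w]nseq_unit.
have in_sound m := @certified_in_sound _ _ _ _ _ _ recog X (size w) m.
have out_sound m := @certified_out_sound _ _ _ _ _ _ recog X (size w) m.
have [|m certm evalm] := cP (code_automata D, code_words X, size w).
  (* Excluded middle enters the proof that the search halts, by completeness on either side. *)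
  have [Cw|nCw] := EM (rule_closure (ar_eq (fun i => (ar i).+1)) (rule D)
    [seq size x | x <- X] (size w)).
    by have [m certm] := certified_in_complete recog Cw; exists m; rewrite /= certm.
  by have [m certm] := certified_out_complete recog nCw; exists m; rewrite /= certm orbT.
exists (certified_in (code_automata D) (code_words X) (size w) m); split=> //.
(* A member admits no certificate of non-membership, so the one found certifies membership. *)
rewrite (generated_closure pres recog); split=> [/in_sound //|Cw].
by case/orP: certm => // /out_sound.
Qed.
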